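(* Let $n>1$ and let $Y$ be a nonzero Hermitian positive semidefinite $n\times n$ complex matrix. Then $Y$ has rank one if and only if all of its $2\times 2$ principal minors are zero.
   Context: A $2\times 2$ principal minor of $Y$ is the determinant of the submatrix of $Y$ with rows and columns indexed by the same pair $\{i,j\}$, $i\neq j$. *)

(* Defs.v *)
From mathcomp Require Import all_boot all_order all_algebra.
From mathcomp Require Import reals complex.

Set Implicit Arguments.
Unset Strict Implicit.
Unset Printing Implicit Defensive.

Import GRing.Theory Num.Theory.
Local Open Scope ring_scope.
Local Open Scope sesquilinear_scope.

(* The order of a numClosedFieldType is partial: [0 <= z] means that [z] is
   real and nonnegative. *)
Definition hermitian_psd (C : numClosedFieldType) (n : nat) (Y : 'M[C]_n) : Prop :=
  Y \is hermsymmx /\ forall v : 'cV[C]_n, 0 <= (v ^t* *m Y *m v) 0 0.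

(* Depends only on the set {i, j}: swapping i and j permutes the rows and the
   columns simultaneously. *)
Definition principal_minor2 (K : comNzRingType) (n : nat) (Y : 'M[K]_n)
    (i j : 'I_n) : K :=
  \det (mxsub (tnth [tuple i; j]) (tnth [tuple i; j]) Y).

(* Main.v *)
Require Import Defs.
From mathcomp Require Import all_boot all_order all_algebra.
From mathcomp Require Import reals complex.
From mathcomp Require Import ring.

Import Order.TTheory GRing.Theory Num.Theory.
Local Open Scope ring_scope.
Local Open Scope sesquilinear_scope.

(* If Y = u v with u a column and v a row, every 2x2 minor vanishes. Conversely,
   if the diagonal were zero the minors would be -|Y_ij|^2, so some Y_kk is nonzero; the
   vector x = Y_kk e_i - Y_ki e_k satisfies x^* Y x = Y_kk * (minor at k, i) = 0,
   and positivity forces Y x = 0, i.e. Y_kk Y_ji = Y_jk Y_ki for all i, j. *)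

Lemma principal_minor2E (K : comNzRingType) (n : nat) (Y : 'M[K]_n) (i j : 'I_n) :
  principal_minor2 Y i j = Y i i * Y j j - Y i j * Y j i.
Proof.
rewrite /principal_minor2 (expand_det_row _ ord0) !big_ord_recl big_ord0 addr0.
by rewrite /cofactor !det_mx11 !mxE /= expr0 expr1 !mul1r mulN1r mulrN.
Qed.

Lemma rank1_principal_minor2 (K : fieldType) (n : nat) (Y : 'M[K]_n) (i j : 'I_n) :
  \rank Y = 1%N -> principal_minor2 Y i j = 0.
Proof.
move=> rY; rewrite principal_minor2E -(mulmx_base Y).
(* Abstracting both factors frees their types, so the inner dimension [\rank Y] can become 1 and
   each entry of the product is a single term. *)
move: (col_base Y) (row_base Y); rewrite rY => u v.
by rewrite !mxE !big_ord1; ring.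
Qed.

Lemma hermsymmx_entry (C : numClosedFieldType) (n : nat) (Y : 'M[C]_n) (i j : 'I_n) :
  Y \is hermsymmx -> Y j i = (Y i j)^*.
Proof.
by move/is_hermitianmxP; rewrite expr0 scale1r => {1}->; rewrite !mxE.
Qed.

Lemma conjtr_combination (C : numClosedFieldType) (m n : nat) (a b : C)
    (A B : 'M[C]_(m, n)) :
  (a *: A - b *: B) ^t* = a^* *: A ^t* - b^* *: B ^t*.
Proof. by apply/matrixP => i j; rewrite !mxE rmorphB !rmorphM. Qed.

(* For w = Y v and t = |w|^2 / (w^* Y w + 1), the form takes the value
   t^2 w^* Y w - 2 t |w|^2 at t w - v, which is negative unless w = 0. *)
Lemma hermitian_psd_isotropic (C : numClosedFieldType) (n : nat) (Y : 'M[C]_n)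
    (v : 'cV[C]_n) :
  hermitian_psd Y -> (v ^t* *m Y *m v) 0 0 = 0 -> Y *m v = 0.
Proof.
case=> hY psdY v0; set w := Y *m v.
have wE : v ^t* *m Y = w ^t*.
  move/is_hermitianmxP: hY; rewrite expr0 scale1r => hY.
  by rewrite /w trmx_mul map_mxM /= -hY.
set q := (w ^t* *m Y *m w) 0 0; have q_ge0 : 0 <= q by exact: psdY.
set p := (w ^t* *m w) 0 0.
have pE : p = \sum_i `|w i 0| ^+ 2.
  by rewrite /p mxE; apply: eq_bigr => i _; rewrite !mxE normCK mulrC.
have p_ge0 : 0 <= p by rewrite pE; apply: sumr_ge0 => i _; rewrite exprn_ge0.
have [p0|p_neq0] := eqVneq p 0.
  apply/matrixP => i j; rewrite ord1 [RHS]mxE; apply/eqP.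
  have /psumr_eq0P-/(_ _ i isT)/eqP : \sum_i `|w i 0| ^+ 2 = 0 by rewrite -pE.
  by rewrite sqrf_eq0 normr_eq0; apply=> k _; rewrite exprn_ge0.
have p_gt0 : 0 < p by rewrite lt0r p_neq0.
have q1_gt0 : 0 < q + 1 by rewrite ltr_wpDl.
set t := p / (q + 1); have t_gt0 : 0 < t by rewrite divr_gt0.
have tC : t^* = t by apply: conj_Creal; rewrite ger0_real// ltW.
(* The scalar 1 gives the vector the shape expected by [conjtr_combination]. *)
have := psdY (t *: w - 1 *: v).
rewrite conjtr_combination tC conjC1 !scale1r.
rewrite !mulmxBl !mulmxBr -!scalemxAl -!scalemxAr wE -!(mulmxA _ Y v) -/w.
have tq : t * (q + 1) = p by rewrite /t divfK// gt_eqF.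
have -> : w ^t* *m v = 0.
  by apply/matrixP => i j; rewrite !ord1 -wE v0 mxE.
have entry (A B : 'M[C]_1) : (t *: (t *: A) - t *: B - (t *: B - 0)) 0 0 =
    t * (t * A 0 0) - t * B 0 0 - t * B 0 0 by rewrite subr0 !mxE.
(* The choice of [t] gives t q = p - t, so t^2 q - 2 t p = -t (p + t). The 1 in the denominator of
   [t] covers the case q = 0. *)
rewrite entry -/p -/q (_ : _ - _ = - (t * (p + t))); last by rewrite -tq; ring.
by rewrite oppr_ge0 => /le_gtF; rewrite mulr_gt0// addr_gt0.
Qed.

(** The minors at i = j, which vanish because of a repeated row, are included in the hypothesis so
    that the argument with the pivot [k] needs no case split on i = k. *)
Lemma rank1_of_principal_minor2 (C : numClosedFieldType) (n : nat) (Y : 'M[C]_n) :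
  Y != 0 -> hermitian_psd Y -> (forall i j, principal_minor2 Y i j = 0) ->
  \rank Y = 1%N.
Proof.
move=> Y_neq0 Ypsd minor0; have hY := Ypsd.1.
have [k Ykk_neq0] : exists k, Y k k != 0.
  apply/existsP; apply: contraNT Y_neq0; rewrite negb_exists => /forallP diag0.
  apply/eqP/matrixP => i j; rewrite mxE; apply/eqP.
  have := minor0 i j; rewrite principal_minor2E (hermsymmx_entry _ _ _ i j hY).
  have /negPn/eqP -> := diag0 i; rewrite mul0r sub0r => /eqP.
  by rewrite oppr_eq0 mul_conjC_eq0.
have YE i j : Y k k * Y j i = Y j k * Y k i.
  pose x : 'cV[C]_n := Y k k *: delta_mx i 0 - Y k i *: delta_mx k 0.
  have Yx j' : (Y *m x) j' 0 = Y k k * Y j' i - Y k i * Y j' k.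
    by rewrite /x mulmxBr -!scalemxAr -!colE !mxE.
  have Yx0 : Y *m x = 0.
    apply: hermitian_psd_isotropic => //.
    (* Only the left factor is expanded, leaving conj(Y_kk) (Y x)_i - conj(Y_ki) (Y x)_k. Here (Y
       x)_i is the minor at k, i, and (Y x)_k cancels by commutativity. *)
    rewrite {1}/x conjtr_combination !trmx_delta !map_delta_mx.
    rewrite -mulmxA mulmxBl -!scalemxAl -!rowE.
    move: (Y *m x) Yx => z Yx; rewrite !mxE !Yx.
    have := minor0 k i. rewrite principal_minor2E => m0.
    have -> : Y k k * Y i i - Y k i * Y i k = 0 by [].
    by ring.
  by apply/eqP; rewrite [Y j k * _]mulrC -subr_eq0 -Yx Yx0 mxE.
(* Dividing [YE] by the pivot factors [Y] through dimension 1, which bounds the rank above; [Y_neq0]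
   bounds it below. *)
have Y_outer : Y = col k Y *m ((Y k k)^-1 *: row k Y).
  apply/matrixP => i j; rewrite mxE big_ord1 !mxE mulrCA.
  by rewrite -YE mulKf.
apply/eqP; rewrite eqn_leq lt0n mxrank_eq0 Y_neq0 andbT.
by rewrite Y_outer mulmx_max_rank.
Qed.

Theorem proposition6 (R : realType) (n : nat) (hn : (1 < n)%N)
    (Y : 'M[R[i]]_n) (Y_neq0 : Y <> 0) (Y_psd : hermitian_psd Y) :
  \rank Y = 1%N <->
  (forall i j : 'I_n, i <> j -> principal_minor2 Y i j = 0).
Proof.
split=> [rY i j _|minor0]; first exact: rank1_principal_minor2.
apply: rank1_of_principal_minor2 => // [|i j]; first exact/eqP.
have [->|/eqP] := eqVneq i j; last exact: minor0.
by rewrite principal_minor2E subrr.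
Qed.
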